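(* Let $\varepsilon'_0$ and $\varepsilon_i$, $i\in\mathbb{Z}$, be i.i.d. real random variables with characteristic function $\varphi$, and let $X_k=g(\dots,\varepsilon_{k-1},\varepsilon_k)$, $k\in\mathbb{Z}$, be a well-defined stationary process ($g$ measurable). Let $0<\alpha\le2$. Assume that $X_k=\varepsilon_k+Y_{k-1}$ for all $k$, where $Y_{k-1}$ is measurable with respect to $\xi_{k-1}=(\dots,\varepsilon_{k-2},\varepsilon_{k-1})$, that $$\int_{\mathbb{R}}|\varphi(t)|^2(1+t^2)|t|^\alpha\,dt<\infty,$$ and that $$\sum_{k=0}^{\infty}\|X_k-X_k^*\|_\alpha^{\alpha/2}<\infty.$$ Then $$\sum_{k=1}^{\infty}\Big[\int_{\mathbb{R}}(1+\theta^2)\,\big\|\varphi_k(\theta\mid\xi_0)-\varphi_k(\theta\mid\xi_0^* )\big\|^2\,d\theta\Big]^{1/2}<\infty.$$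
   Context: Notation: $\xi_k=(\dots,\varepsilon_{k-1},\varepsilon_k)$; for $k\ge0$, $\xi_k^*=(\xi_{-1},\varepsilon'_0,\varepsilon_1,\dots,\varepsilon_k)$ and $X_k^*=g(\xi_k^* )$ (the coupled version of $X_k$ with $\varepsilon_0$ replaced by $\varepsilon'_0$). $\|Z\|_p=(\mathbb{E}|Z|^p)^{1/p}$ and $\|Z\|=\|Z\|_2$. The conditional characteristic function is $\varphi_k(\theta\mid\xi_0)=\mathbb{E}(e^{\sqrt{-1}\theta X_k}\mid\xi_0)$, viewed as a function of the history $\xi_0$, and $\varphi_k(\theta\mid\xi_0^* )$ is that function evaluated at $\xi_0^*$. *)

(* Defs.v *)
From HB Require Import structures.
From mathcomp Require Import all_boot all_order all_algebra.
From mathcomp Require Import all_classical all_reals all_analysis.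
Set Implicit Arguments. Unset Strict Implicit. Unset Printing Implicit Defensive.
Import Order.TTheory GRing.Theory Num.Theory.
Import numFieldNormedType.Exports.
Local Open Scope classical_set_scope.
Local Open Scope ring_scope.

(* Histories: a history (..., e_{-1}, e_0) is encoded as h : nat -> R with
   h j = e_{-j} (h 0 is the most recent innovation). *)

Definition seq_cylinders (R : realType) : set (set (nat -> R)) :=
  \bigcup_(n in [set: nat]) preimage_set_system setT (fun h : nat -> R => h n) measurable.

Definition seq_measurable (R : realType) (A : set (nat -> R)) : Prop :=
  smallest (sigma_algebra setT) (@seq_cylinders R) A.

Definition seq_measurable_fun (R : realType) (g : (nat -> R) -> R) : Prop :=
  forall B : set R, measurable B -> seq_measurable (g @^-1` B).

Definition mutually_independent (R : realType) (d : measure_display)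
  (T : measurableType d) (P : probability T R) (I : eqType) (e : I -> T -> R) : Prop :=
  (forall i, measurable_fun setT (e i)) /\
  forall (s : seq I) (B : I -> set R), uniq s -> (forall i, measurable (B i)) ->
    P (\big[setI/setT]_(i <- s) (e i @^-1` B i)) =
    (\prod_(i <- s) P (e i @^-1` B i))%E.

Definition identically_distributed (R : realType) (d : measure_display)
  (T : measurableType d) (P : probability T R) (I : Type) (e : I -> T -> R) : Prop :=
  forall i j (B : set R), measurable B -> P (e i @^-1` B) = P (e j @^-1` B).

Definition innov_family (R : realType) (T : Type) (eps : int -> T -> R)
  (eps0' : T -> R) : option int -> T -> R :=
  fun o => match o with None => eps0' | Some i => eps i end.

Definition xi (R : realType) (T : Type) (eps : int -> T -> R) (k : int) (w : T)
  : nat -> R := fun j => eps (k - j%:Z) w.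

Definition eps_star (R : realType) (T : Type) (eps : int -> T -> R) (eps0' : T -> R)
  : int -> T -> R := fun i w => if i == 0 then eps0' w else eps i w.

Definition Xproc (R : realType) (T : Type) (g : (nat -> R) -> R)
  (eps : int -> T -> R) (k : int) (w : T) : R := g (xi eps k w).

Definition Xstar (R : realType) (T : Type) (g : (nat -> R) -> R)
  (eps : int -> T -> R) (eps0' : T -> R) (k : int) (w : T) : R :=
  g (xi (eps_star eps eps0') k w).

Definition cf_re (R : realType) (d : measure_display) (T : measurableType d)
  (P : probability T R) (X : T -> R) (t : R) : R :=
  Rintegral P setT (fun w => cos (t * X w)).
Definition cf_im (R : realType) (d : measure_display) (T : measurableType d)
  (P : probability T R) (X : T -> R) (t : R) : R :=
  Rintegral P setT (fun w => sin (t * X w)).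

(* the history xi_k obtained by appending eps_1(w), ..., eps_k(w) to h = xi_0 *)
Definition hist_ext (R : realType) (T : Type) (eps : int -> T -> R) (k : nat)
  (h : nat -> R) (w : T) : nat -> R :=
  fun j => if (j < k)%N then eps (k%:Z - j%:Z) w else h (j - k)%N.

(* phi_k(theta | h) = E(exp(i theta X_k) | xi_0 = h), real and imaginary parts,
   computed by integrating over the future innovations eps_1..eps_k,
   which are independent of xi_0 *)
Definition ccf_re (R : realType) (d : measure_display) (T : measurableType d)
  (P : probability T R) (g : (nat -> R) -> R) (eps : int -> T -> R) (k : nat)
  (theta : R) (h : nat -> R) : R :=
  Rintegral P setT (fun w => cos (theta * g (hist_ext eps k h w))).
Definition ccf_im (R : realType) (d : measure_display) (T : measurableType d)
  (P : probability T R) (g : (nat -> R) -> R) (eps : int -> T -> R) (k : nat)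
  (theta : R) (h : nat -> R) : R :=
  Rintegral P setT (fun w => sin (theta * g (hist_ext eps k h w))).

(* Main.v *)
Require Import Defs.
From HB Require Import structures.
From mathcomp Require Import all_boot all_order all_algebra.
From mathcomp Require Import all_classical all_reals all_analysis.
From mathcomp Require Import measurable_realfun ring lra zify.
Set Implicit Arguments.
Unset Strict Implicit.
Unset Printing Implicit Defensive.
Import Order.TTheory GRing.Theory Num.Theory.
Import numFieldNormedType.Exports.
Local Open Scope classical_set_scope.
Local Open Scope ring_scope.

(** Write [X_k = eps_k + Y_{k-1}] and mark the coupled quantities (the stars of
    the paper) by a prime.  Integrating out [eps_k], which is independent
    of everything [Y_{k-1}] depends on, gives for [k >= 1]
    [phi_k(th | xi_0) = phi(th) E(exp(i th Y_{k-1}) | xi_0)], so by Jensen and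
    [|exp(ix) - exp(iy)|^2 <= 4 |x - y|^alpha]
    [|| phi_k(th | xi_0) - phi_k(th | xi_0') ||^2
       <= 4 |phi(th)|^2 |th|^alpha E|X_k - X_k'|^alpha],
    because [X_k - X_k' = Y_{k-1} - Y_{k-1}'].  Integrating against
    [(1 + th^2) dth] and taking square roots leaves a constant multiple of
    [|| X_k - X_k' ||_alpha^(alpha/2)].

    Since [phi_k(th | h)] is defined for every history [h] by integrating over
    the innovations [eps_1, ..., eps_k], the conditioning is realised on
    [P \x P]: the past is read off the first sample point and the future off
    the second one.  By independence this does not change the joint law of the
    innovations. *)

(** * Laws on path space and their finite-dimensional marginals *)

Definition coord_sets (R : realType) (I : Type) : set (set (I -> R)) :=
  \bigcup_(i in [set: I])
    preimage_set_system setT (fun h : I -> R => h i) measurable.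

(** For [I = nat] the generators are those of [seq_cylinders], so [seq_measurable] is measurability
    in [path_space R nat] by conversion. *)
Notation path_space R I := (g_sigma_algebraType (@coord_sets R I)).

Definition box (R : realType) (I : eqType) (s : seq I) (B : I -> set R) :
    set (path_space R I) :=
  [set h | forall i, i \in s -> B i (h i)].

Lemma measurable_coord (R : realType) (I : Type) (i : I) :
  measurable_fun setT (fun h : path_space R I => h i).
Proof.
move=> _ B mB; apply: sub_sigma_algebra.
by exists i => //; exists B.
Qed.

Lemma measurable_path (R : realType) (I : Type) (d : measure_display)
    (X : measurableType d) (f : X -> path_space R I) :
  (forall i, measurable_fun setT (fun x => f x i)) -> measurable_fun setT f.
Proof.
move=> mf; apply: (@measurability _ _ X (path_space R I) setT f (@coord_sets R I)) => //.
move=> _ [_ [i _ [B mB <-]] <-].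
rewrite setTI [X in measurable X](_ : _ = setT `&` (fun x => f x i) @^-1` B).
  exact: mf.
by rewrite !setTI.
Qed.

Lemma preimage_box (R : realType) (I : eqType) (T : Type)
    (Z : T -> path_space R I) (s : seq I) (B : I -> set R) :
  Z @^-1` box s B = \big[setI/setT]_(i <- s) ((fun w => Z w i) @^-1` B i).
Proof.
elim: s => [|i s IH]; first by rewrite big_nil; apply/seteqP; split.
rewrite big_cons -IH; apply/seteqP; split => h /=.
  by move=> H; split=> [|j js]; apply: H; rewrite in_cons ?eqxx// js orbT.
by move=> [Bi H] j; rewrite in_cons => /orP[/eqP->|/H].
Qed.

Lemma measurable_box (R : realType) (I : eqType) (s : seq I) (B : I -> set R) :
  (forall i, measurable (B i)) -> measurable (box s B).
Proof.
move=> mB; rewrite -[box s B]preimage_id preimage_box; apply: bigsetI_measurable => i _.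
by rewrite -[X in measurable X]setTI; exact: measurable_coord.
Qed.

(** Boxes are stable under intersection, generate the sigma-algebra, and include the whole space as
    the box over the empty list; two measures that agree on such a pi-system agree everywhere once
    the total mass is finite. *)
Lemma path_measure_unique (R : realType) (I : eqType)
    (mu nu : {measure set (path_space R I) -> \bar R}) :
  (mu setT < +oo)%E ->
  (forall s B, uniq s -> (forall i, measurable (B i)) ->
    mu (box s B) = nu (box s B)) ->
  forall A, measurable A -> mu A = nu A.
Proof.
move=> mufin munu.
pose G : set (set (path_space R I)) := [set A | exists s B,
  [/\ uniq s, forall i, measurable (B i) & A = box s B]].
have GT : G setT.
  by exists [::], (fun=> setT); split => //; apply/seteqP; split.
apply: (measure_unique G (fun=> setT)) => //.
- apply/seteqP; split; last first.
    apply: smallest_sub; first exact: sigma_algebra_measurable.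
    by move=> _ [s [B [_ mB ->]]]; exact: measurable_box.
  apply: smallest_sub; first exact: smallest_sigma_algebra.
  move=> _ [i _ [B mB <-]]; apply: sub_sigma_algebra.
  exists [:: i], (fun=> B); split => //.
  apply/seteqP; split=> h /=; last by move=> /(_ i); rewrite inE eqxx => /(_ isT).
  by move=> [_ Bh] j; rewrite inE => /eqP->.
(* The intersection is a box over the merged list; a coordinate listed in only one of the two boxes
   gets [setT] from the other. *)
- move=> _ _ [s [B [us mB ->]]] [t [C [ut mC ->]]].
  exists (undup (s ++ t)), (fun i => (if i \in s then B i else setT) `&`
    (if i \in t then C i else setT)); split.
  + exact: undup_uniq.
  + by move=> i; apply: measurableI; case: ifPn.
  + apply/seteqP; split => h /=.
      move=> [Bh Ch] i _; split.
        by case: ifPn => // /Bh.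
      by case: ifPn => // /Ch.
    move=> H; split=> i si; have := H i; rewrite mem_undup mem_cat si ?orbT.
      by move=> /(_ isT)[].
    by move=> /(_ isT)[].
- by apply/seteqP; split => // x _; exists 0%N.
- by move=> _ [s [B [us mB ->]]]; exact: munu.
Qed.

Section same_law.
Context (R : realType) (I : eqType) (d1 d2 : measure_display).
Context (T1 : measurableType d1) (T2 : measurableType d2).
Context (P1 : probability T1 R) (P2 : probability T2 R).
Variables (Z1 : T1 -> path_space R I) (Z2 : T2 -> path_space R I).
Hypotheses (mZ1 : measurable_fun setT Z1) (mZ2 : measurable_fun setT Z2).
Hypothesis Z12 : forall s B, uniq s -> (forall i, measurable (B i)) ->
  P1 (Z1 @^-1` box s B) = P2 (Z2 @^-1` box s B).

Lemma same_law A : measurable A -> P1 (Z1 @^-1` A) = P2 (Z2 @^-1` A).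
Proof.
pose HB1 := isMeasurableFun.Build _ _ _ _ Z1 mZ1.
pose HB2 := isMeasurableFun.Build _ _ _ _ Z2 mZ2.
pose W1 : {mfun T1 >-> path_space R I} := HB.pack Z1 HB1.
pose W2 : {mfun T2 >-> path_space R I} := HB.pack Z2 HB2.
apply: (@path_measure_unique _ _ (pushforward P1 W1) (pushforward P2 W2)) => //=.
by rewrite /pushforward preimage_setT probability_setT ltry.
Qed.

Lemma same_law_ge0_integral (F : path_space R I -> \bar R) :
  measurable_fun setT F -> (forall z, 0 <= F z)%E ->
  (\int[P1]_w F (Z1 w) = \int[P2]_w F (Z2 w))%E.
Proof.
move=> mF F0.
pose HB1 := isMeasurableFun.Build _ _ _ _ Z1 mZ1.
pose HB2 := isMeasurableFun.Build _ _ _ _ Z2 mZ2.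
pose W1 : {mfun T1 >-> path_space R I} := HB.pack Z1 HB1.
pose W2 : {mfun T2 >-> path_space R I} := HB.pack Z2 HB2.
have := @ge0_integral_pushforward _ _ _ _ _ W1 mZ1 P1 setT F measurableT mF.
rewrite preimage_setT => <-; last by move=> *; exact: F0.
have := @ge0_integral_pushforward _ _ _ _ _ W2 mZ2 P2 setT F measurableT mF.
rewrite preimage_setT => <-; last by move=> *; exact: F0.
by apply: eq_measure_integral => A mA _; exact: same_law.
Qed.

Lemma same_law_integral (F : path_space R I -> \bar R) :
  measurable_fun setT F ->
  (\int[P1]_w F (Z1 w) = \int[P2]_w F (Z2 w))%E.
Proof.
move=> mF; rewrite integralE [RHS]integralE; congr (_ - _)%E.
  under eq_integral do rewrite funeposE.
  under [RHS]eq_integral do rewrite funeposE.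
  apply: (@same_law_ge0_integral (fun z => maxe (F z) 0)%E).
    by apply: measurable_maxe => //; exact: measurable_cst.
  by move=> z; rewrite le_max lexx orbT.
under eq_integral do rewrite funenegE.
under [RHS]eq_integral do rewrite funenegE.
apply: (@same_law_ge0_integral (fun z => maxe (- F z) 0)%E).
  by apply: measurable_maxe; [exact: measurableT_comp|exact: measurable_cst].
by move=> z; rewrite le_max lexx orbT.
Qed.

End same_law.

(** * Independent families: reindexing and resampling *)

Lemma mutually_independent_comp (R : realType) (d : measure_display)
    (T : measurableType d) (P : probability T R) (I J : eqType)
    (e : I -> T -> R) (f : J -> I) :
  injective f -> mutually_independent P e ->
  mutually_independent P (fun j => e (f j)).
Proof.
move=> finj [me ie]; split=> [j|s B us mB]; first exact: me.
(* The sets [B j] are carried along [f]: injectivity gives [C (f j) = B j], and [C i] is [setT] off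
   the range of [f], so every [C i] is measurable. *)
pose C i := [set x | forall j, f j = i -> B j x].
have CE j : C (f j) = B j.
  by apply/seteqP; split=> x /=; [exact|move=> Bx j' /finj ->].
have mC i : measurable (C i).
  have [[j <-]|/forallNP nj] := pselect (exists j, f j = i); first by rewrite CE.
  rewrite (_ : C i = setT)//; apply/seteqP; split => // x _ j /nj//.
have := ie (map f s) C; rewrite !big_map (map_inj_uniq finj) => /(_ us mC).
under eq_bigr do rewrite CE.
by under [in RHS]eq_bigr do rewrite CE.
Qed.

Lemma measurable_family (R : realType) (d : measure_display)
    (T : measurableType d) (P : probability T R) (I : eqType) (e : I -> T -> R) :
  mutually_independent P e ->
  measurable_fun setT (fun w => (fun i => e i w) : path_space R I).
Proof. by move=> [me _]; exact: measurable_path. Qed.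

Section iid.
Context (R : realType) (d : measure_display) (T : measurableType d).
Context (P : probability T R) (I J : eqType) (e : I -> T -> R) (f1 f2 : J -> I).
Hypotheses (ie : mutually_independent P e) (de : identically_distributed P e).
Hypotheses (f1i : injective f1) (f2i : injective f2).

Let mZ (f : J -> I) : injective f ->
  measurable_fun setT (fun w => (fun j => e (f j) w) : path_space R J).
Proof.
by move=> fi; exact/(@measurable_family _ _ _ P)/mutually_independent_comp.
Qed.

Let iid_box (s : seq J) (B : J -> set R) :
  uniq s -> (forall i, measurable (B i)) ->
  P ((fun w => (fun j => e (f1 j) w) : path_space R J) @^-1` box s B) =
  P ((fun w => (fun j => e (f2 j) w) : path_space R J) @^-1` box s B).
Proof.
move=> us mB; rewrite !preimage_box.
have [_ ->//] := mutually_independent_comp f1i ie.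
have [_ ->//] := mutually_independent_comp f2i ie.
by apply: eq_bigr => j _; exact: de.
Qed.

(** Each box probability is a product of marginals, which are all equal. This is what allows [eps0']
    to be put in the place of [eps 0] without changing the law of a history. *)
Lemma iid_prob (A : set (path_space R J)) : measurable A ->
  P [set w | A (fun j => e (f1 j) w)] = P [set w | A (fun j => e (f2 j) w)].
Proof. by apply: same_law; [exact: mZ|exact: mZ|exact: iid_box]. Qed.

Lemma iid_integral (F : path_space R J -> \bar R) : measurable_fun setT F ->
  (\int[P]_w F (fun j => e (f1 j) w) = \int[P]_w F (fun j => e (f2 j) w))%E.
Proof. by apply: same_law_integral; [exact: mZ|exact: mZ|exact: iid_box]. Qed.

End iid.

(* The coordinates in [s] are read off an independent copy of the sample
   point. *)
Definition resample (R : realType) (T : Type) (I : eqType) (e : I -> T -> R)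
    (s : pred I) (w : T * T) : path_space R I :=
  fun i => if s i then e i w.2 else e i w.1.

Section resample.
Context (R : realType) (d : measure_display) (T : measurableType d).
Context (P : probability T R) (I : eqType) (e : I -> T -> R) (s : pred I).
Hypothesis ie : mutually_independent P e.

Lemma measurable_resample : measurable_fun setT (resample e s).
Proof.
have [me _] := ie; apply: measurable_path => i; rewrite /resample.
by case: (s i); apply: measurableT_comp (me i) _.
Qed.

(** The preimage of a box under [resample] is a rectangle, with one side for the coordinates outside
    [s] and one for those inside. Independence factorises each side, and the two products recombine
    to the one over [r]. *)
Lemma resample_box (r : seq I) (B : I -> set R) :
  uniq r -> (forall i, measurable (B i)) ->
  P ((fun w => (fun i => e i w) : path_space R I) @^-1` box r B) =
  (P \x P)%E (resample e s @^-1` box r B).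
Proof.
move=> ur mB; have [_ ieP] := ie; have mZ := measurable_family ie.
rewrite [X in _ = (P \x P)%E X](_ : _ =
  ((fun w => (fun i => e i w) : path_space R I) @^-1`
     box [seq i <- r | ~~ s i] B) `*`
  ((fun w => (fun i => e i w) : path_space R I) @^-1`
     box [seq i <- r | s i] B)); last first.
  apply/seteqP; split=> -[w1 w2] /=.
    move=> H; split=> i /=; rewrite mem_filter => /andP[si ir].
      by have := H i ir; rewrite /resample (negbTE si).
    by have := H i ir; rewrite /resample si.
  move=> [H1 H2] i ir; rewrite /resample; have [si|si] := boolP (s i).
    by apply: H2; rewrite mem_filter si.
  by apply: H1; rewrite mem_filter si.
rewrite product_measure1E; last 2 first.
- by rewrite -[X in measurable X]setTI; apply: mZ => //; exact: measurable_box.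
- by rewrite -[X in measurable X]setTI; apply: mZ => //; exact: measurable_box.
rewrite !preimage_box /= (ieP r)// (ieP [seq i <- r | ~~ s i]) ?filter_uniq//.
rewrite (ieP [seq i <- r | s i]) ?filter_uniq// !big_filter.
by rewrite (bigID s) /=; exact: muleC.
Qed.

Lemma resample_prob (A : set (path_space R I)) : measurable A ->
  P [set w | A (fun i => e i w)] = (P \x P)%E (resample e s @^-1` A).
Proof.
move=> mA; apply: (@same_law _ _ _ _ _ _ P (P \x P)%E
    (fun w i => e i w) (resample e s)) => //.
- exact: measurable_family ie.
- exact: measurable_resample.
- exact: resample_box.
Qed.

Lemma resample_integral (F : path_space R I -> \bar R) :
  measurable_fun setT F ->
  (\int[P]_w F (fun i => e i w) = \int[P \x P]_w F (resample e s w))%E.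
Proof.
move=> mF; apply: (@same_law_integral _ _ _ _ _ _ P (P \x P)%E
    (fun w i => e i w) (resample e s)) => //.
- exact: measurable_family ie.
- exact: measurable_resample.
- exact: resample_box.
Qed.

End resample.

(** * Integral inequalities and bounds on sine and cosine *)

Lemma bounded_integrable (R : realType) (d : measure_display)
    (T : measurableType d) (P : probability T R) (M : R) (f : T -> R) :
  measurable_fun setT f -> (forall w, `|f w| <= M) ->
  P.-integrable setT (EFin \o f).
Proof.
move=> mf fM; apply: measurable_bounded_integrable => //.
  by apply: le_lt_trans (probability_le1 P measurableT) _; rewrite ltry.
exists M; split; first exact: num_real.
by move=> x Mx w _ /=; apply: le_trans (fM w) (ltW Mx).
Qed.

(** Measurability is asked of [g] only, because the lemma is applied to integrands [f] built from
    [phi_k] whose measurability is not established. Raising [g] to [+oo] on the exceptional null set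
    keeps its integral and makes the inequality hold everywhere; then every simple function below
    [f] is below the new [g]. *)
Lemma le_ae_integral (R : realType) (d : measure_display)
    (T : measurableType d) (mu : {measure set T -> \bar R}) (f g : T -> \bar R) :
  (forall x, 0 <= f x)%E -> (forall x, 0 <= g x)%E -> measurable_fun setT g ->
  {ae mu, forall x, (f x <= g x)%E} -> (\int[mu]_x f x <= \int[mu]_x g x)%E.
Proof.
move=> f0 g0 mg [N [mN N0 fgN]].
pose g' x := if x \in N then +oo%E else g x.
have mg' : measurable_fun setT g'.
  apply: measurable_fun_ifT => //.
  by apply: (measurable_fun_bool true); rewrite setTI /preimage/= set_mem_set.
have <- : (\int[mu]_x g' x = \int[mu]_x g x)%E.
  apply: ae_eq_integral => //; exists N; split => // x /= H.
  apply: contrapT => Nx; apply: H => _; rewrite /g' ifN//.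
  by apply/negP; rewrite inE.
have g'0 x : (0 <= g' x)%E by rewrite /g'; case: ifPn.
rewrite !ge0_integralTE//; apply: le_ereal_sup => _ [h /= hf <-].
exists h => //= x; apply: le_trans (hf x) _; rewrite /g'.
case: ifPn => [_|/negP]; first exact: leey.
rewrite inE => Nx; apply: contrapT => fg; exact/Nx/fgN.
Qed.

(** The product measure of the complement of [A] is the integral of the measures of its sections; a
    nonnegative function with zero integral vanishes almost everywhere. *)
Lemma product_null_sections (R : realType) (d1 d2 : measure_display)
    (T1 : measurableType d1) (T2 : measurableType d2)
    (P1 : {measure set T1 -> \bar R})
    (P2 : {sigma_finite_measure set T2 -> \bar R}) (A : set (T1 * T2)) :
  measurable A -> (P1 \x P2)%E (~` A) = 0%E ->
  {ae P1, forall x, {ae P2, forall y, A (x, y)}}.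
Proof.
move=> mA A0; have mCA := measurableC mA.
have /(ae_eq_integral_abs P1 measurableT) : (\int[P1]_x `|P2 (xsection (~` A) x)| = 0)%E.
  by under eq_integral do rewrite gee0_abs//.
move=> /(_ (measurable_fun_xsection _ mCA)); apply: filterS => x /(_ I) H.
exists (xsection (~` A) x); split => //; first exact: measurable_xsection.
by move=> y /= ny; rewrite /xsection /= inE.
Qed.

(** Jensen for the square: with [c] the mean of [f], expand the nonnegative integral of
    [(f - c) ^+ 2]. *)
Lemma sqr_Rintegral_le (R : realType) (d : measure_display)
    (T : measurableType d) (P : probability T R) (M : R) (f : T -> R) :
  measurable_fun setT f -> (forall w, `|f w| <= M) ->
  Rintegral P setT f ^+ 2 <= Rintegral P setT (fun w => f w ^+ 2).
Proof.
move=> mf fM; set c := Rintegral P setT f.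
have i2 : P.-integrable setT (EFin \o (fun w => f w ^+ 2)).
  apply: (@bounded_integrable _ _ _ _ (M ^+ 2)); first exact: measurable_funX.
  move=> w; rewrite normrX ler_sqr ?nnegrE//.
  by apply: le_trans (fM w); exact: normr_ge0.
have i1 : P.-integrable setT (EFin \o f) by exact: bounded_integrable fM.
have i1c : P.-integrable setT (EFin \o (fun w => 2 * c * f w)).
  apply: (@bounded_integrable _ _ _ _ (`|2 * c| * M)).
    by apply: measurable_funM => //; exact: measurable_cst.
  by move=> w; rewrite normrM ler_wpM2l.
have : 0 <= Rintegral P setT (fun w => (f w ^+ 2 - 2 * c * f w) + c ^+ 2).
  apply: Rintegral_ge0 => w _.
  by rewrite (_ : _ + _ = (f w - c) ^+ 2) ?sqr_ge0//; ring.
rewrite RintegralD//; last 2 first.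
- by apply: (integrableB measurableT i2 i1c).
- by apply: (@bounded_integrable _ _ _ _ `|c ^+ 2|); first exact: measurable_cst.
rewrite RintegralB// RintegralZl// -/c Rintegral_cst//= probability_setT/=.
lra.
Qed.

Lemma sin_le_id (R : realType) (x : R) : 0 <= x -> sin x <= x.
Proof.
rewrite le_eqVlt => /predU1P[<-|x0]; first by rewrite sin0.
have [c _] := @MVT R sin cos 0 x x0 (fun y _ => is_derive_sin y)
  (continuous_subspaceT (@continuous_sin R)).
rewrite sin0 !subr0 => ->; rewrite ler_piMl ?cos_le1//; exact: ltW.
Qed.

Lemma normr_sin_le_id (R : realType) (x : R) : `|sin x| <= `|x|.
Proof.
wlog x0 : x / 0 <= x => [H|].
  have [/H//|x0] := leP 0 x.
  by rewrite -normrN -sinN -[leRHS]normrN; apply: H; rewrite oppr_ge0 ltW.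
have [x1|x1] := leP x 1; last first.
  by apply: le_trans (sin_max x) _; rewrite (ger0_norm x0) ltW.
rewrite (ger0_norm x0) ger0_norm; first exact: sin_le_id.
apply: sin_ge0_pi; rewrite x0/=; apply: le_trans x1 _.
by apply: le_trans (pi_ge2 R); lra.
Qed.

(** The left side is the squared chord [4 sin(u)^2] with [u = (x - y) / 2]. If [|x - y| >= 1], bound
    the sine by 1; otherwise [sin(u)^2 <= |x - y|^2 <= |x - y|^alpha], the last step because
    [alpha <= 2]. *)
Lemma cos_sin_dist_le (R : realType) (alpha x y : R) : 0 < alpha -> alpha <= 2 ->
  (cos x - cos y) ^+ 2 + (sin x - sin y) ^+ 2 <= 4 * `|x - y| `^ alpha.
Proof.
move=> a0 a2; set u := (x - y) / 2.
have -> : (cos x - cos y) ^+ 2 + (sin x - sin y) ^+ 2 = 4 * `|sin u| ^+ 2.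
  have xyE : x - y = u + u by rewrite /u; field.
  have := cosB x y; rewrite xyE cosD -!expr2 => xy.
  have := cos2Dsin2 x; have := cos2Dsin2 y; have := cos2Dsin2 u.
  by rewrite real_normK ?num_real//; lra.
rewrite ler_pM2l//.
have [xy1|xy1] := leP 1 `|x - y|.
  apply: le_trans (_ : 1 <= _).
    by rewrite expr_le1//; exact: sin_max.
  by rewrite -(powRr0 `|x - y|) ler_powR// ltW.
have [xy|xy0] := eqVneq x y.
  by rewrite /u xy subrr mul0r sin0 normr0 expr0n /= powR_ge0.
have xyp : 0 < `|x - y| by rewrite normr_gt0 subr_eq0.
apply: (@le_trans _ _ (`|x - y| ^+ 2)).
  rewrite ler_sqr ?nnegrE//; apply: le_trans (normr_sin_le_id _) _.
  by rewrite /u normrM [`|2^-1|]ger0_norm ?invr_ge0// ler_piMr//; lra.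
by rewrite -powR_mulrn//; apply: ger_powR => //; rewrite xyp ltW.
Qed.

Lemma EFin_Rintegral (R : realType) (d : measure_display) (T : measurableType d)
    (P : probability T R) (M : R) (f : T -> R) :
  measurable_fun setT f -> (forall w, `|f w| <= M) ->
  (\int[P]_w (f w)%:E = (Rintegral P setT f)%:E)%E.
Proof.
move=> mf fM; rewrite /Rintegral fineK//; apply: integrable_fin_num => //.
exact: (bounded_integrable P mf fM).
Qed.

Lemma ae_eq_Rintegral (R : realType) (d : measure_display) (T : measurableType d)
    (P : probability T R) (f g : T -> R) :
  measurable_fun setT f -> measurable_fun setT g ->
  {ae P, forall w, f w = g w} -> Rintegral P setT f = Rintegral P setT g.
Proof.
move=> mf mg fg; congr fine; apply: ae_eq_integral => //.
- exact/measurable_EFinP.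
- exact/measurable_EFinP.
- by apply: filterS fg => w -> _.
Qed.

Lemma measurable_cosZ (R : realType) (d : measure_display) (T : measurableType d)
    (c : R) (f : T -> R) :
  measurable_fun setT f -> measurable_fun setT (fun w => cos (c * f w)).
Proof.
move=> mf; apply: measurableT_comp.
  by apply: continuous_measurable_fun; exact: continuous_cos.
by apply: measurable_funM => //; exact: measurable_cst.
Qed.

Lemma measurable_sinZ (R : realType) (d : measure_display) (T : measurableType d)
    (c : R) (f : T -> R) :
  measurable_fun setT f -> measurable_fun setT (fun w => sin (c * f w)).
Proof.
move=> mf; apply: measurableT_comp.
  by apply: continuous_measurable_fun; exact: continuous_sin.
by apply: measurable_funM => //; exact: measurable_cst.
Qed.

(** * Integrating out a single innovation *)

Definition ignores (R : realType) (I : eqType) (V : Type) (i0 : I)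
    (Phi : (I -> R) -> V) : Prop :=
  forall z z', (forall i, i != i0 -> z i = z' i) -> Phi z = Phi z'.

Section one_coordinate.
Context (R : realType) (d : measure_display) (T : measurableType d).
Context (P : probability T R) (I : eqType) (e : I -> T -> R) (i0 : I).
Hypothesis ie : mutually_independent P e.

Let me i : measurable_fun setT (e i).
Proof. by have [] := ie. Qed.

Let mZ := measurable_family ie.

(** Resample the coordinate [i0] alone: [u] then reads the second sample point, [Phi], which ignores
    [i0], reads the first, and Fubini splits the integral. *)
Lemma Rintegral_indep (u : R -> R) (Phi : path_space R I -> R) :
  measurable_fun setT u -> (forall x, `|u x| <= 1) ->
  measurable_fun setT Phi -> (forall z, `|Phi z| <= 1) -> ignores i0 Phi ->
  Rintegral P setT (fun w => u (e i0 w) * Phi (fun i => e i w)) =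
  Rintegral P setT (fun w => u (e i0 w)) *
  Rintegral P setT (fun w => Phi (fun i => e i w)).
Proof.
move=> mu u1 mPhi Phi1 Phi0.
have mue : measurable_fun setT (fun w => u (e i0 w)) by exact: measurableT_comp.
have mPe : measurable_fun setT (fun w => Phi (fun i => e i w)).
  exact: measurableT_comp mPhi mZ.
have mF : measurable_fun setT (fun z : path_space R I => (u (z i0) * Phi z)%:E).
  apply/measurable_EFinP/measurable_funM => //.
  by apply: measurableT_comp mu _; exact: measurable_coord.
rewrite {1}/Rintegral (resample_integral (pred1 i0) ie mF).
have FE (w : T * T) : (u (resample e (pred1 i0) w i0) *
    Phi (resample e (pred1 i0) w))%:E =
    (u (e i0 w.2) * Phi (fun i => e i w.1))%:E.
  rewrite {1}/resample /= eqxx; congr (_ * _)%:E; apply: Phi0 => i ii0.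
  by rewrite /resample /= (negbTE ii0).
under eq_integral do rewrite FE.
have mprod : measurable_fun setT
    (fun w : T * T => u (e i0 w.2) * Phi (fun i => e i w.1)).
  apply: measurable_funM; first exact: measurableT_comp mue measurable_snd.
  exact: measurableT_comp mPe measurable_fst.
have bprod (w : T * T) : `|u (e i0 w.2) * Phi (fun i => e i w.1)| <= 1.
  by rewrite normrM mulr_ile1.
rewrite -integral12_prod_meas1; last exact: (bounded_integrable _ mprod bprod).
rewrite /fubini_F /=.
set cu := Rintegral P setT (fun w => u (e i0 w)).
have inner x : (\int[P]_y (u (e i0 y) * Phi (fun i => e i x))%:E =
    (cu * Phi (fun i => e i x))%:E)%E.
  rewrite (@EFin_Rintegral _ _ _ _ 1) => [||w].
  - congr EFin; rewrite RintegralZr//.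
    exact: (bounded_integrable P mue (fun w => u1 _)).
  - by apply: measurable_funM => //; exact: measurable_cst.
  - exact: (bprod (x, w)).
under eq_integral do rewrite inner.
rewrite -/(Rintegral P setT (fun x => cu * Phi (fun i => e i x))) RintegralZl//.
exact: (bounded_integrable P mPe (fun w => Phi1 _)).
Qed.

Section cf_bound.
Variables (Y : path_space R I -> R) (th : R).
Hypotheses (mY : measurable_fun setT Y) (Y0 : ignores i0 Y).

Let Yw w := Y (fun i => e i w).

Let ib (f : T -> R) : measurable_fun setT f -> (forall w, `|f w| <= 1) ->
  P.-integrable setT (EFin \o f).
Proof. exact: bounded_integrable. Qed.

Let mYw : measurable_fun setT Yw.
Proof. exact: measurableT_comp mY mZ. Qed.

Let mc := @measurable_cosZ R _ R th id (@measurable_id _ _ _).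
Let ms := @measurable_sinZ R _ R th id (@measurable_id _ _ _).
Let cY0 : ignores i0 (fun z => cos (th * Y z)).
Proof. by move=> z z' zz'; rewrite (Y0 zz'). Qed.
Let sY0 : ignores i0 (fun z => sin (th * Y z)).
Proof. by move=> z z' zz'; rewrite (Y0 zz'). Qed.

Let bM (x y : R) : `|x| <= 1 -> `|y| <= 1 -> `|x * y| <= 1.
Proof. by move=> ? ?; rewrite normrM mulr_ile1. Qed.

(** Real part of [E exp(i th (e + Y)) = phi(th) E exp(i th Y)], from the addition formula and
    independence; the imaginary part follows below. *)
Lemma Rintegral_cosD :
  Rintegral P setT (fun w => cos (th * (e i0 w + Yw w))) =
  cf_re P (e i0) th * Rintegral P setT (fun w => cos (th * Yw w)) -
  cf_im P (e i0) th * Rintegral P setT (fun w => sin (th * Yw w)).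
Proof.
have [cY sY] := (measurable_cosZ th mY, measurable_sinZ th mY).
rewrite /cf_re /cf_im.
rewrite -(Rintegral_indep mc (fun x => cos_max _) cY (fun z => cos_max _) cY0).
rewrite -(Rintegral_indep ms (fun x => sin_max _) sY (fun z => sin_max _) sY0).
rewrite -RintegralB//.
- by apply: eq_Rintegral => w _; rewrite mulrDr cosD.
- apply: ib => [|w]; last by apply: bM; exact: cos_max.
  by apply: measurable_funM; exact: measurable_cosZ.
- apply: ib => [|w]; last by apply: bM; exact: sin_max.
  by apply: measurable_funM; exact: measurable_sinZ.
Qed.

Lemma Rintegral_sinD :
  Rintegral P setT (fun w => sin (th * (e i0 w + Yw w))) =
  cf_im P (e i0) th * Rintegral P setT (fun w => cos (th * Yw w)) +
  cf_re P (e i0) th * Rintegral P setT (fun w => sin (th * Yw w)).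
Proof.
have [cY sY] := (measurable_cosZ th mY, measurable_sinZ th mY).
rewrite /cf_re /cf_im.
rewrite -(Rintegral_indep ms (fun x => sin_max _) cY (fun z => cos_max _) cY0).
rewrite -(Rintegral_indep mc (fun x => cos_max _) sY (fun z => sin_max _) sY0).
rewrite -RintegralD//.
- by apply: eq_Rintegral => w _; rewrite mulrDr sinD.
- apply: ib => [|w]; last by apply: bM; [exact: sin_max|exact: cos_max].
  by apply: measurable_funM; [exact: measurable_sinZ|exact: measurable_cosZ].
- apply: ib => [|w]; last by apply: bM; [exact: cos_max|exact: sin_max].
  by apply: measurable_funM; [exact: measurable_cosZ|exact: measurable_sinZ].
Qed.

End cf_bound.

(** [U] and [U'] contain the same innovation [e i0], so its characteristic function factors out of
    the difference; Jensen and the chord bound do the rest. The right side is kept as an extended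
    integral since the moment of order [alpha] may be infinite. *)
Lemma cf_dist_le (Y Y' : path_space R I -> R) (U U' : T -> R) (th alpha : R) :
  0 < alpha -> alpha <= 2 ->
  measurable_fun setT Y -> ignores i0 Y ->
  measurable_fun setT Y' -> ignores i0 Y' ->
  measurable_fun setT U -> measurable_fun setT U' ->
  {ae P, forall w, U w = e i0 w + Y (fun i => e i w)} ->
  {ae P, forall w, U' w = e i0 w + Y' (fun i => e i w)} ->
  (((cf_re P U th - cf_re P U' th) ^+ 2 +
    (cf_im P U th - cf_im P U' th) ^+ 2)%:E <=
   \int[P]_w (4 * (cf_re P (e i0) th ^+ 2 + cf_im P (e i0) th ^+ 2)
     * `|th| `^ alpha * `|U w - U' w| `^ alpha)%:E)%E.
Proof.
move=> a0 a2 mY Y0 mY' Y0' mU mU' UY UY'.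
pose V w := Y (fun i => e i w); pose V' w := Y' (fun i => e i w).
have mV : measurable_fun setT V by exact: measurableT_comp mY mZ.
have mV' : measurable_fun setT V' by exact: measurableT_comp mY' mZ.
have reE (W : T -> R) (X : path_space R I -> R) :
    measurable_fun setT X -> ignores i0 X -> measurable_fun setT W ->
    {ae P, forall w, W w = e i0 w + X (fun i => e i w)} ->
    cf_re P W th = Rintegral P setT (fun w => cos (th * (e i0 w + X (fun i => e i w)))).
  move=> mX X0 mW WX; apply: ae_eq_Rintegral; first exact: measurable_cosZ.
    by apply/measurable_cosZ/measurable_funD => //; exact: measurableT_comp mX mZ.
  by apply: filterS WX => w ->.
have imE (W : T -> R) (X : path_space R I -> R) :
    measurable_fun setT X -> ignores i0 X -> measurable_fun setT W ->
    {ae P, forall w, W w = e i0 w + X (fun i => e i w)} ->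
    cf_im P W th = Rintegral P setT (fun w => sin (th * (e i0 w + X (fun i => e i w)))).
  move=> mX X0 mW WX; apply: ae_eq_Rintegral; first exact: measurable_sinZ.
    by apply/measurable_sinZ/measurable_funD => //; exact: measurableT_comp mX mZ.
  by apply: filterS WX => w ->.
rewrite (reE U Y)// (reE U' Y')// (imE U Y)// (imE U' Y')//.
rewrite !Rintegral_cosD// !Rintegral_sinD//.
rewrite -/(V _) -/(V' _).
set a := cf_re P _ _; set b := cf_im P _ _.
set c1 := Rintegral P setT (fun w => cos (th * V w)).
set c2 := Rintegral P setT (fun w => cos (th * V' w)).
set s1 := Rintegral P setT (fun w => sin (th * V w)).
set s2 := Rintegral P setT (fun w => sin (th * V' w)).
have [mcV msV] := (measurable_cosZ th mV, measurable_sinZ th mV).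
have [mcV' msV'] := (measurable_cosZ th mV', measurable_sinZ th mV').
pose fc w := cos (th * V w) - cos (th * V' w).
pose fs w := sin (th * V w) - sin (th * V' w).
have mfc : measurable_fun setT fc by exact: measurable_funB.
have mfs : measurable_fun setT fs by exact: measurable_funB.
have bfc w : `|fc w| <= 2.
  by apply: le_trans (ler_normB _ _) _; have := cos_max (th * V w);
     have := cos_max (th * V' w); lra.
have bfs w : `|fs w| <= 2.
  by apply: le_trans (ler_normB _ _) _; have := sin_max (th * V w);
     have := sin_max (th * V' w); lra.
have cE : c1 - c2 = Rintegral P setT fc.
  rewrite -RintegralB//; apply: bounded_integrable => // w; exact: cos_max.
have sE : s1 - s2 = Rintegral P setT fs.
  rewrite -RintegralB//; apply: bounded_integrable => // w; exact: sin_max.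
(* The squared modulus of a product of complex numbers is the product of the squared moduli, here in
   real coordinates. *)
rewrite [X in X%:E](_ : _ =
  (a ^+ 2 + b ^+ 2) * ((c1 - c2) ^+ 2 + (s1 - s2) ^+ 2)); last by ring.
have bsq (f : T -> R) : (forall w, `|f w| <= 2) -> forall w, `|f w ^+ 2| <= 4.
  move=> bf w; rewrite normrX (_ : 4 = 2 ^+ 2) ?ler_sqr ?nnegrE//; ring.
have icc : P.-integrable setT (EFin \o (fun w => fc w ^+ 2)).
  apply: (@bounded_integrable _ _ _ _ 4); first exact: measurable_funX.
  exact: bsq.
have iss : P.-integrable setT (EFin \o (fun w => fs w ^+ 2)).
  apply: (@bounded_integrable _ _ _ _ 4); first exact: measurable_funX.
  exact: bsq.
have mcs : measurable_fun setT (fun w => fc w ^+ 2 + fs w ^+ 2).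
  by apply: measurable_funD; exact: measurable_funX.
have ab0 : 0 <= a ^+ 2 + b ^+ 2 by rewrite addr_ge0 ?sqr_ge0.
apply: (@le_trans _ _ ((a ^+ 2 + b ^+ 2) *
    Rintegral P setT (fun w => fc w ^+ 2 + fs w ^+ 2))%:E).
  rewrite lee_fin ler_wpM2l// RintegralD// cE sE.
  by rewrite lerD//; [exact: (sqr_Rintegral_le _ mfc bfc)|
                      exact: (sqr_Rintegral_le _ mfs bfs)].
rewrite -RintegralZl//; last exact: (integrableD measurableT icc iss).
(* The 8 bounds [fc w ^+ 2 + fs w ^+ 2], each square being at most 4; it serves integrability
   only. *)
rewrite -(@EFin_Rintegral _ _ _ _ ((a ^+ 2 + b ^+ 2) * 8)); last 2 first.
- by apply: measurable_funM => //; exact: measurable_cst.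
- move=> w; rewrite normrM (ger0_norm ab0) ler_wpM2l//.
  apply: le_trans (ler_normD _ _) _.
  by have := bsq _ bfc w; have := bsq _ bfs w; lra.
apply: le_ae_integral.
- by move=> w; rewrite lee_fin mulr_ge0// addr_ge0// sqr_ge0.
- by move=> w; rewrite lee_fin !mulr_ge0// powR_ge0.
- apply/measurable_EFinP/measurable_funM; first exact: measurable_cst.
  apply: (measurableT_comp (measurable_powR alpha)).
  by apply: measurableT_comp => //; exact: measurable_funB.
near=> w; rewrite lee_fin.
(* The common innovation cancels. *)
have -> : U w - U' w = V w - V' w.
  have -> : U w = e i0 w + V w by near: w.
  have -> : U' w = e i0 w + V' w by near: w.
  by rewrite opprD addrACA subrr add0r.
apply: (@le_trans _ _ ((a ^+ 2 + b ^+ 2) * (4 * `|th * V w - th * V' w| `^ alpha))).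
  by rewrite ler_wpM2l// cos_sin_dist_le.
rewrite -mulrBr normrM powRM//.
by rewrite le_eqVlt; apply/orP; left; apply/eqP; ring.
Unshelve. all: by end_near.
Qed.

End one_coordinate.

(** * The coupled histories and the bound for one index [k] *)

Section innovations.
Context (R : realType) (d : measure_display) (T : measurableType d).
Context (P : probability T R) (eps : int -> T -> R) (eps0' : T -> R).

Let e := innov_family eps eps0'.
Hypotheses (ie : mutually_independent P e) (de : identically_distributed P e).

Lemma cf_innov_re (k : int) (th : R) : cf_re P (eps k) th = cf_re P (eps 0) th.
Proof.
congr fine.
(* With the one-point index set [unit], equality of laws on path space reduces to equality of two
   marginals. *)
apply: (@iid_integral _ _ _ P _ unit e (fun=> Some k) (fun=> Some 0) ie de _ _
  (fun h => (cos (th * h tt))%:E)) => [[] []//|[] []//|].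
by apply/measurable_EFinP/measurable_cosZ; exact: measurable_coord.
Qed.

Lemma cf_innov_im (k : int) (th : R) : cf_im P (eps k) th = cf_im P (eps 0) th.
Proof.
congr fine.
apply: (@iid_integral _ _ _ P _ unit e (fun=> Some k) (fun=> Some 0) ie de _ _
  (fun h => (sin (th * h tt))%:E)) => [[] []//|[] []//|].
by apply/measurable_EFinP/measurable_sinZ; exact: measurable_coord.
Qed.

(* With [star] set, time 0 reads the replacement innovation [eps0']. *)
Definition slot (star : bool) (i : int) : option int :=
  if star && (i == 0) then None else Some i.

(** The replacement [eps0'], encoded by [None], counts as past, because it enters the coupled
    history at time 0. *)
Definition future (o : option int) : bool := if o is Some i then 0 < i else false.

Lemma slot_inj star : injective (slot star).
Proof.
rewrite /slot => i j; case: star => /=; last by case.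
by case: eqP => [->|_]; case: eqP => [->|_] // -[].
Qed.

Lemma slot_gt0 star (i : int) : 0 < i -> slot star i = Some i.
Proof. by move=> i0; rewrite /slot gt_eqF// andbF. Qed.

Lemma future_slot star (i : int) : future (slot star i) = (0 < i).
Proof. by rewrite /slot; case: star; case: (eqVneq i 0) => [->|]. Qed.

Let E (star : bool) := if star then eps_star eps eps0' else eps.

Let eE star i w : e (slot star i) w = E star i w.
Proof. by rewrite /E /eps_star /slot; case: star => //=; case: ifP. Qed.

Definition window (star : bool) (k : int) (z : path_space R (option int)) :
  path_space R nat := fun j => z (slot star (k - j%:Z)).

Lemma measurable_window star k : measurable_fun setT (window star k).
Proof. by apply: measurable_path => j; exact: measurable_coord. Qed.

Lemma xi_window star k w : xi (E star) k w = window star k (fun o => e o w).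
Proof. by apply/funext => j; rewrite /xi /window eE. Qed.

(** This ties the definition of [phi_k] to [resample]: positions [j < k] have positive time, hence
    are future and untouched by the coupling, while the others are read from the past. *)
Lemma hist_ext_window star (k : nat) (w : T * T) :
  hist_ext eps k (xi (E star) 0 w.1) w.2 =
  window star k%:Z (resample e future w).
Proof.
apply/funext => j; rewrite /hist_ext /window /resample future_slot subr_gt0.
rewrite ltz_nat; case: ltnP => jk.
  by rewrite slot_gt0// subr_gt0 ltz_nat.
by rewrite eE /xi -subzn// sub0r opprB.
Qed.

Section one_step.
Variables (g G : (nat -> R) -> R) (k : nat).
Hypotheses (mg : seq_measurable_fun g) (mG : seq_measurable_fun G).
Hypothesis k0 : (0 < k)%N.
Hypothesis gG : {ae P, forall w,
  Xproc g eps k%:Z w = eps k%:Z w + G (xi eps (k%:Z - 1) w)}.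

Let mg' : measurable_fun setT (g : path_space R nat -> R).
Proof. by move=> _ B mB; rewrite setTI; exact: mg. Qed.

Let mG' : measurable_fun setT (G : path_space R nat -> R).
Proof. by move=> _ B mB; rewrite setTI; exact: mG. Qed.

(** The histories at which [X_k = eps_k + Y_{k-1}] holds: [h 0] is the latest innovation and the
    shifted sequence is the history up to [k - 1]. *)
Let A : set (path_space R nat) := [set h | g h = h 0%N + G (fun j => h j.+1)].

Let mA : measurable A.
Proof.
have mt : measurable_fun setT (fun h : path_space R nat =>
    ((fun j => h j.+1) : path_space R nat)).
  by apply: measurable_path => j; exact: measurable_coord.
have mr : measurable_fun setT
    (fun h : path_space R nat => h 0%N + G (fun j => h j.+1)).
  apply: measurable_funD; first exact: measurable_coord.
  exact: measurableT_comp mG' mt.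
have mtrue : measurable [set true] by [].
have := measurable_fun_eqr mg' mr measurableT mtrue.
rewrite setTI [X in measurable X -> _](_ : _ = A)//.
by apply/seteqP; split=> h /= /eqP.
Qed.

(** The assumption [gG] concerns the original process only. The coupled history at time [k] has the
    same law, so it also lies in [A] almost surely; resampling and null sections turn this into a
    statement for almost every past and almost every future. *)
Lemma ae_hist_ext star : {ae P, forall w', {ae P, forall w,
  A (hist_ext eps k (xi (E star) 0 w') w)}}.
Proof.
pose A' := [set z | A (window star k%:Z z)].
have mA' : measurable A'.
  by rewrite -[X in measurable X]setTI; exact: measurable_window.
suff : (P \x P)%E (~` (resample e future @^-1` A')) = 0%E.
  move=> H; have := product_null_sections _ H.
  have mr : measurable (resample e future @^-1` A').
    by rewrite -[X in measurable X]setTI; exact: (measurable_resample future ie).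
  move=> /(_ mr); apply: filterS => w'; apply: filterS => w.
  by rewrite /= /A' /= -hist_ext_window.
rewrite preimage_setC -(resample_prob future ie (measurableC mA')).
have := @iid_prob _ _ _ P _ nat e (fun j => slot star (k%:Z - j%:Z))
  (fun j => slot false (k%:Z - j%:Z)) ie de _ _ _ (measurableC mA).
rewrite /A' /window /= => ->.
- apply: measure_negligible.
    rewrite -[X in measurable X]setTI.
    exact: (measurableT_comp (measurable_window false k%:Z)
      (measurable_family ie) measurableT (measurableC mA)).
  case: gG => N [mN N0 sN]; exists N; split => // w /= nA; apply: sN => /= H.
  apply: nA; rewrite /A /=; move: H; rewrite /Xproc /xi subr0 => ->.
  congr (_ + G _); apply/funext => j; congr eps.
  by rewrite -addn1 PoszD; lia.
- by move=> i j /slot_inj; lia.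
- by move=> i j /slot_inj; lia.
Qed.

(** By resampling and Tonelli the right side becomes an integral over the past [w'] of integrals
    over the future [w]. For almost every fixed past, [cf_dist_le] applies with [eps k] as the
    shared innovation. *)
Lemma ccf_dist_le (alpha th : R) : 0 < alpha -> alpha <= 2 ->
  (\int[P]_w
     (((ccf_re P g eps k th (xi eps 0 w)
        - ccf_re P g eps k th (xi (eps_star eps eps0') 0 w)) ^+ 2
      + (ccf_im P g eps k th (xi eps 0 w)
        - ccf_im P g eps k th (xi (eps_star eps eps0') 0 w)) ^+ 2)%:E) <=
   (4 * (cf_re P (eps 0) th ^+ 2 + cf_im P (eps 0) th ^+ 2) * `|th| `^ alpha)%:E *
   \int[P]_w (`|Xproc g eps k%:Z w - Xstar g eps eps0' k%:Z w| `^ alpha)%:E)%E.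
Proof.
move=> a0 a2; set C := 4 * _ * _.
have C0 : 0 <= C by rewrite !mulr_ge0 ?powR_ge0// addr_ge0 ?sqr_ge0.
pose q (z : path_space R (option int)) :=
  `|g (window false k%:Z z) - g (window true k%:Z z)| `^ alpha.
have mq : measurable_fun setT q.
  apply: (measurableT_comp (measurable_powR alpha)).
  apply: measurableT_comp => //; apply: measurable_funB;
  by apply: measurableT_comp mg' _; exact: measurable_window.
have mCq : measurable_fun setT (fun z => (C * q z)%:E).
  by apply/measurable_EFinP/measurable_funM => //; exact: measurable_cst.
have mCqr := measurableT_comp mCq (measurable_resample future ie).
have Cq0 z : (0 <= (C * q z)%:E)%E by rewrite lee_fin mulr_ge0// powR_ge0.
have -> : (C%:E * \int[P]_w (`|Xproc g eps k%:Z w -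
      Xstar g eps eps0' k%:Z w| `^ alpha)%:E =
    \int[P]_w' \int[P]_w (C * q (resample e future (w', w)))%:E)%E.
  transitivity (\int[P \x P]_z (C * q (resample e future z))%:E)%E; last first.
    exact: (fubini_tonelli1 _ mCqr (fun w => Cq0 _)).
  rewrite -(resample_integral future ie mCq).
  under [RHS]eq_integral do rewrite EFinM.
  rewrite ge0_integralZl//.
  - congr (_ * _)%E; apply: eq_integral => w _.
    by rewrite /q -(xi_window false) -(xi_window true).
  - apply/measurable_EFinP.
    exact: (measurableT_comp mq (measurable_family ie)).
  - by move=> w _; rewrite lee_fin powR_ge0.
apply: le_ae_integral.
- by move=> w; rewrite lee_fin addr_ge0 ?sqr_ge0.
- by move=> w; apply: integral_ge0 => w' _; exact: Cq0.
- exact: (measurable_fun_fubini_tonelli_F _ mCqr (fun w => Cq0 _)).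
have := ae_hist_ext false; have := ae_hist_ext true.
apply: filterS2 => w' At Af.
(* This is [Y_{k-1}] with the past frozen at [w']. It reads times at most [k - 1], hence ignores the
   coordinate [Some k]. *)
pose Y star (z : path_space R (option int)) := G (fun j =>
  let i := slot star (k%:Z - j.+1%:Z) in if future i then z i else e i w').
have mY star : measurable_fun setT (Y star).
  apply: measurableT_comp mG' _; apply: measurable_path => j /=.
  by case: future; [exact: measurable_coord|exact: measurable_cst].
have Y0 star : ignores (Some k%:Z) (Y star).
  move=> z z' zz'; congr G; apply/funext => j /=; case: future => //.
  by apply: zz'; rewrite /slot; case: ifP => // _; apply/eqP => -[]; lia.
have mU star : measurable_fun setT
    (fun w => g (hist_ext eps k (xi (E star) 0 w') w)).
  under eq_fun do rewrite (hist_ext_window star k (w', _)).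
  apply: measurableT_comp mg' _; apply: measurableT_comp (measurable_window _ _) _.
  by apply: measurableT_comp (measurable_resample future ie) _.
have UY star : {ae P, forall w, A (hist_ext eps k (xi (E star) 0 w') w)} ->
    {ae P, forall w, g (hist_ext eps k (xi (E star) 0 w') w) =
      e (Some k%:Z) w + Y star (fun i => e i w)}.
  apply: filterS => w ->.
  rewrite (hist_ext_window star k (w', w)) /window /resample /= subr0.
  by rewrite future_slot ltz_nat k0 slot_gt0.
have := @cf_dist_le _ _ _ P _ e (Some k%:Z) ie (Y false) (Y true)
  _ _ th alpha a0 a2 (mY _) (Y0 _) (mY _) (Y0 _) (mU _) (mU _) (UY _ Af) (UY _ At).
rewrite /= cf_innov_re cf_innov_im -/C => /le_trans; apply.
under eq_integral do rewrite (hist_ext_window false k (w', _))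
   (hist_ext_window true k (w', _)).
by [].
Qed.

End one_step.
End innovations.

(** * Measurability in the frequency and the final summation *)

Lemma measurable_cf (R : realType) (d : measure_display) (T : measurableType d)
    (P : probability T R) (X : T -> R) (u : R -> R) :
  measurable_fun setT X -> measurable_fun setT u -> (forall x, `|u x| <= 1) ->
  measurable_fun setT (fun t : R => Rintegral P setT (fun w => u (t * X w))).
Proof.
move=> mX mu u1.
(* Adding 1 makes the integrand nonnegative, so Tonelli gives measurability in [t]; the 1 is
   subtracted at the end. *)
have mF : measurable_fun setT (fun p : R * T => (1 + u (p.1 * X p.2))%:E).
  apply/measurable_EFinP/measurable_funD; first exact: measurable_cst.
  apply: measurableT_comp mu _; apply: measurable_funM => //.
  exact: measurableT_comp mX measurable_snd.
have F0 (p : R * T) : (0 <= (1 + u (p.1 * X p.2))%:E)%E.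
  by rewrite lee_fin; have := u1 (p.1 * X p.2); rewrite ler_norml; lra.
have := measurable_fun_fubini_tonelli_F (m2 := P) _ mF F0.
rewrite [X in measurable_fun _ X](_ : _ = EFin \o
    (fun t => 1 + Rintegral P setT (fun w => u (t * X w)))); last first.
  apply/funext => t; rewrite /fubini_F /=.
  have mut : measurable_fun setT (fun w => u (t * X w)).
    apply: measurableT_comp mu _; apply: measurable_funM => //.
  rewrite (@EFin_Rintegral _ _ _ _ 2); last 2 first.
  - by apply: measurable_funD => //; exact: measurable_cst.
  - move=> w; apply: le_trans (ler_normD _ _) _; rewrite normr1.
    by have := u1 (t * X w); lra.
  rewrite RintegralD//; last 2 first.
  - by apply: (@bounded_integrable _ _ _ _ `|1|); first exact: measurable_cst.
  - exact: (bounded_integrable P mut (fun w => u1 _)).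
  by rewrite Rintegral_cst//= probability_setT /= mulr1.
move=> /measurable_EFinP m1.
rewrite (_ : (fun t => _) =
    (fun t => 1 + Rintegral P setT (fun w => u (t * X w)) - 1)).
  by apply: measurable_funB => //; exact: measurable_cst.
by apply/funext => t; rewrite addrAC subrr add0r.
Qed.

Theorem theorem2p2 (R : realType) (d : measure_display) (T : measurableType d)
  (P : probability T R) (eps : int -> T -> R) (eps0' : T -> R)
  (g : (nat -> R) -> R) (alpha : R) :
  mutually_independent P (innov_family eps eps0') ->
  identically_distributed P (innov_family eps eps0') ->
  seq_measurable_fun g ->
  0 < alpha -> alpha <= 2 ->
  (forall k : int, exists G : (nat -> R) -> R, seq_measurable_fun G /\
     {ae P, forall w, Xproc g eps k w = eps k w + G (xi eps (k - 1) w)}) ->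
  (\int[lebesgue_measure]_t
     (((cf_re P (eps 0) t) ^+ 2 + (cf_im P (eps 0) t) ^+ 2)
        * (1 + t ^+ 2) * (`|t| `^ alpha))%:E < +oo)%E ->
  (\sum_(0 <= k <oo)
     (Lnorm P alpha%:E (fun w => (Xproc g eps k%:Z w - Xstar g eps eps0' k%:Z w)%:E)
        `^ (alpha / 2)) < +oo)%E ->
  (\sum_(1 <= k <oo)
     ((\int[lebesgue_measure]_th
         ((1 + th ^+ 2)%:E *
          \int[P]_w
            (((ccf_re P g eps k th (xi eps 0 w)
               - ccf_re P g eps k th (xi (eps_star eps eps0') 0 w)) ^+ 2
             + (ccf_im P g eps k th (xi eps 0 w)
               - ccf_im P g eps k th (xi (eps_star eps eps0') 0 w)) ^+ 2)%:E)))
      `^ (2^-1)) < +oo)%E.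
Proof.
move=> ie de mg a0 a2 Hdec; set K := (\int[_]_t _)%E => Kfin Hsum.
have me : measurable_fun setT (eps 0) by have [/(_ (Some 0))] := ie.
pose phi2 t := cf_re P (eps 0) t ^+ 2 + cf_im P (eps 0) t ^+ 2.
pose h t := phi2 t * (1 + t ^+ 2) * `|t| `^ alpha.
pose M k := (\int[P]_w
  (`|Xproc g eps k%:Z w - Xstar g eps eps0' k%:Z w| `^ alpha)%:E)%E.
have M0 k : (0 <= M k)%E.
  by apply: integral_ge0 => w _; rewrite lee_fin powR_ge0.
have phi0 t : 0 <= phi2 t by rewrite addr_ge0 ?sqr_ge0.
have t20 (t : R) : 0 <= 1 + t ^+ 2 by rewrite addr_ge0 ?sqr_ge0.
have h0 t : (0 <= (h t)%:E)%E by rewrite lee_fin !mulr_ge0 ?powR_ge0.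
have K0 : (0 <= K)%E by apply: integral_ge0 => t _; exact: h0.
have mh : measurable_fun setT (EFin \o h).
  apply/measurable_EFinP/measurable_funM; first apply: measurable_funM.
  - apply: measurable_funD; apply: measurable_funX; apply: measurable_cf => //.
    + by apply: continuous_measurable_fun; exact: continuous_cos.
    + by move=> x; exact: cos_max.
    + by apply: continuous_measurable_fun; exact: continuous_sin.
    + by move=> x; exact: sin_max.
  - by apply: measurable_funD => //; exact: measurable_cst.
  - by apply: (measurableT_comp (measurable_powR alpha)).
(* The 4 is the constant of [ccf_dist_le], and [K] is what the integral over the frequency
   contributes. *)
pose c := ((4%:E * K) `^ 2^-1)%E.
set u := (X in (\sum_(1 <= k <oo) X k)%E).
set v := (X in (\sum_(0 <= k <oo) X k < _)%E) in Hsum.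
(* The norm raised to [alpha / 2] is the square root of the moment of order [alpha]. *)
have vE k : v k = (M k `^ 2^-1)%E.
  by rewrite /v poweRrM poweR_Lnorm ?gt_eqF//.
have u0 k : (0 <= u k)%E by exact: poweR_ge0.
have v0 k : (0 <= v k)%E by exact: poweR_ge0.
(* Positivity of [k] matters: for [k = 0] no innovation is integrated out, so no factor [phi]
   appears. *)
have uv k : (0 < k)%N -> (u k <= c * v k)%E.
  move=> k0; have [G [mG gG]] := Hdec k%:Z.
  rewrite vE /c -poweRM ?mule_ge0 ?lee_fin//.
  apply: gt0_ler_poweR; rewrite ?invr_ge0// ?in_itv/= ?leey ?andbT//.
  - apply: integral_ge0 => t _; apply: mule_ge0; first by rewrite lee_fin.
    by apply: integral_ge0 => w _; rewrite lee_fin addr_ge0 ?sqr_ge0.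
  - by rewrite !mule_ge0// lee_fin.
  have -> : (4%:E * K * M k = \int[lebesgue_measure]_t (4%:E * M k * (h t)%:E))%E.
    by rewrite ge0_integralZl ?mule_ge0 ?lee_fin// muleAC.
  apply: le_ae_integral.
  - move=> t; apply: mule_ge0; first by rewrite lee_fin.
    by apply: integral_ge0 => w _; rewrite lee_fin addr_ge0 ?sqr_ge0.
  - by move=> t; rewrite !mule_ge0// lee_fin.
  - exact: measurable_funeM.
  apply: aeW => t.
  apply: le_trans (lee_wpmul2l _ (ccf_dist_le ie de mg mG k0 gG t a0 a2)) _.
    by rewrite lee_fin.
  rewrite -/(M k) muleA -EFinM muleAC -EFinM.
  rewrite [X in (X%:E * _)%E](_ : _ = 4 * h t)//.
  by rewrite /h /phi2; ring.
have c0 : (0 <= c)%E by exact: poweR_ge0.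
have cfin : c \is a fin_num.
  by rewrite fin_num_poweR// fin_numM// ge0_fin_numE.
apply: (@le_lt_trans _ _ (\sum_(0 <= k <oo) c * v k)%E).
  (* The sum from 1 is viewed as a sum from 0 restricted to [0 < k]; dropping the restriction adds
     only the nonnegative term at 0. *)
  rewrite eseries_cond.
  apply: (@le_trans _ _ (\sum_(0 <= k <oo | true && (0 < k)%N) c * v k)%E).
    by apply: lee_nneseries => [k _ _|k /andP[_ /uv]]; first exact: u0.
  apply: subset_lee_nneseries => // k _; exact: mule_ge0.
by rewrite -(fineK cfin) nneseriesZl// lte_mul_pinfty// lee_fin fine_ge0.
Qed.
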